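(* Consider the system, the matrices $P,K,\Pi,\bar K$ and the sequences $\Pi_k,\bar K_k$ described in the context, where $\bar K_0+K$ is a $\gamma$-stabilizer of $(A+G,B)$ (i.e. $\sqrt\gamma(A+G-BK-B\bar K_0)$ is Schur), Assumptions 1 and 2 hold, and either Assumption 3 or Assumption 4 holds. For $k\ge0$ put $$\Lambda_k^2=\gamma B^{T}\Pi_kB,\qquad \bar{\mathcal{K}}_{k+1}=(R+\Lambda_k^2)(K+\bar K_{k+1}),\qquad \bar Q_k=(K+\bar K_k)^{T}R(K+\bar K_k)+Q+Q_\Gamma .$$ Let $\bar x_t=\mathbb{E}\big[\frac1N\sum_{i=1}^Nx_{it}\big]\in\mathbb{R}^n$ and $\bar u_t=\mathbb{E}\big[\frac1N\sum_{i=1}^Nu_{it}\big]\in\mathbb{R}^m$ for $t=1,\dots,l$. Let $\mathfrak{A}_k^2$ be the matrix with $l-1$ rows whose $t$-th row ($1\le t\le l-1$) is $$\Big[\,s(\bar x_t)^{T}-\gamma\, s(\bar x_{t+1})^{T},\;\; 2\,\bar x_t^{T}\otimes\bar u_t^{T}+2\,(\bar x_t^{T}\otimes\bar x_t^{T})(I_n\otimes (K+\bar K_k)^{T}),\;\; s(\bar u_t)^{T}-s((K+\bar K_k)\bar x_t)^{T}\Big],$$ and let $\mathfrak{B}_k^2\in\mathbb{R}^{l-1}$ have $t$-th entry $s(\bar x_t)^{T}\mathrm{svec}(\bar Q_k)=\bar x_t^T\bar Q_k\bar x_t$. Suppose that $l-1\ge \frac{n(n+1)}2+nm+\frac{m(m+1)}2$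 and that the matrix $\mathfrak{I}^2$ with rows $[\,s(\bar x_t)^{T},\ \bar x_t^{T}\otimes\bar u_t^{T},\ s(\bar u_t)^{T}]$, $1\le t\le l-1$, has rank $\frac{n(n+1)}2+nm+\frac{m(m+1)}2$. Then for every $k\ge 0$ the matrix $\mathfrak{A}_k^{2T}\mathfrak{A}_k^{2}$ is invertible and $$\begin{bmatrix}\mathrm{svec}(\Pi_k)\\ \mathrm{vec}(\bar{\mathcal{K}}_{k+1})\\ \mathrm{svec}(\Lambda_k^2)\end{bmatrix}=(\mathfrak{A}_k^{2T}\mathfrak{A}_k^{2})^{-1}\mathfrak{A}_k^{2T}\mathfrak{B}_k^{2},$$ and moreover (a) $\lim_{k\to\infty}\Pi_k=\Pi$; (b) $\lim_{k\to\infty}\big((R+\Lambda_k^2)^{-1}\bar{\mathcal{K}}_{k+1}-K\big)=\bar K$.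
   Context: System. $A,G,Q,\Gamma\in\mathbb{R}^{n\times n}$, $B\in\mathbb{R}^{n\times m}$, $R\in\mathbb{R}^{m\times m}$, $Q,R$ symmetric, $0<\gamma<1$, $D$ a matrix of appropriate size, $Q_\Gamma=\Gamma^{T}Q\Gamma-Q\Gamma-\Gamma^{T}Q$. There are $N$ agents with states $x_{it}\in\mathbb{R}^n$ and inputs $u_{it}\in\mathbb{R}^m$ ($1\le i\le N$, time $t\ge0$) obeying $x_{i(t+1)}=Ax_{it}+Gx_t^{(N)}+Bu_{it}+Dw_{it}$, where $x_t^{(N)}=\frac1N\sum_{i=1}^N x_{it}$, $w_{it}$ are independent white noises with zero mean and variance $\sigma^2$, and the applied inputs are arbitrary random vectors with finite expectation. The data are the quantities at times $t=1,\dots,l$. Riccati equations. $P$ is the stabilizing solution of $P=\gamma A^{T}PA-\gamma^{2}A^{T}PB(R+\gamma B^{T}PB)^{-1}B^{T}PA+Q$, and $K=\gamma(R+\gamma B^{T}PB)^{-1}B^{T}PA$. $\Pi$ is the stabilizing solution of $$\Pi=\gamma(A+G)^{T}\Pi(A+G)-\gamma^{2}(A+G)^{T}\Pi B(R+\gamma B^{T}\Pi B)^{-1}B^{T}\Pi(A+G)+Q+Q_\Gamma,$$ and $\bar K=\gamma(R+\gamma B^{T}\Pi B)^{-1}B^{T}\Pi(A+G)-K$. Stabilizing means: symmetric, the inverse in the equation exists, and $\sqrt\gamma(A-BK)$, respectively $\sqrt\gamma(A+G-BK-B\bar K)$, is Schur. Policy iteration. For $k=0,1,2,\dots$, $\Pi_k$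 (symmetric) and $\bar K_{k+1}$ solve $$\Pi_k=\gamma\bar A_k^{T}\Pi_k\bar A_k+(K+\bar K_k)^{T}R(K+\bar K_k)+Q+Q_\Gamma,\quad \bar A_k=A+G-BK-B\bar K_k,$$ $$\bar K_{k+1}=\gamma(R+\gamma B^{T}\Pi_kB)^{-1}B^{T}\Pi_k(A+G)-K$$ (including that the inverse exists), started from $\bar K_0$. Assumption 1. The initial states $\{x_{i0}\}_{i=1}^N$ are mutually independent and independent of the noises; they have the same mathematical expectation and finite second moments. Assumption 2. $(A,B)$ and $(A+G,B)$ are $\gamma$-stabilizable, i.e. there are $F_1,F_2\in\mathbb{R}^{m\times n}$ such that $\sqrt\gamma(A-BF_1)$ and $\sqrt\gamma(A+G-BF_2)$ are Schur. Assumption 3. $Q\ge0$, $R>0$, and the pairs $(\sqrt{\gamma}A,\sqrt{Q})$ and $(\sqrt{\gamma}(A+G),\sqrt{Q}(I-\Gamma))$ are detectable. (Here $(M,C)$ is detectable if there is $L$ with $M+LC$ Schur.) Assumption 4. There exist symmetric $\tilde P,\tilde\Pi\in\mathbb{R}^{n\times n}$ with $\mathcal{H}(\tilde P)>0$ and $\bar{\mathcal{H}}(\tilde\Pi)>0$, where $$\mathcal{H}(P)=\begin{bmatrix}\gamma A^{T}PA-P+Q&\gamma A^{T}PB\\ \gamma B^{T}PA&R+\gamma B^{T}PB\end{bmatrix},$$ $$\bar{\mathcal{H}}(\Pi)=\begin{bmatrix}\gamma(A+G)^{T}\Pi(A+G)-\Pi+Q+Q_\Gamma&\gamma(A+G)^{T}\Pi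 B\\ \gamma B^{T}\Pi(A+G)&R+\gamma B^{T}\Pi B\end{bmatrix}.$$ Notation. Schur: all eigenvalues have modulus $<1$. $\otimes$ is the Kronecker product. $\mathrm{vec}$ stacks the columns of a matrix. For symmetric $M\in\mathbb{R}^{p\times p}$, $\mathrm{svec}(M)=[M_{11},2M_{12},\dots,2M_{1p},M_{22},2M_{23},\dots,2M_{p-1,p},M_{pp}]^{T}\in\mathbb{R}^{p(p+1)/2}$. For $z\in\mathbb{R}^p$, $s(z)=[z_1^2,z_1z_2,\dots,z_1z_p,z_2^2,z_2z_3,\dots,z_{p-1}z_p,z_p^2]^{T}\in\mathbb{R}^{p(p+1)/2}$, so that $s(z)^{T}\mathrm{svec}(M)=z^{T}Mz$. *)

(* Defs.v *)
From HB Require Import structures.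
From mathcomp Require Import all_boot all_order all_algebra.
From mathcomp Require Import finmap complex mxtens.
From mathcomp Require Import all_classical all_reals all_analysis.

Set Implicit Arguments.
Unset Strict Implicit.
Unset Printing Implicit Defensive.

Import Order.TTheory GRing.Theory Num.Theory.
Import numFieldNormedType.Exports.

Local Open Scope classical_set_scope.
Local Open Scope ring_scope.

Section Matrices.
Context {R : realType}.

Definition schur n (M : 'M[R]_n) : Prop :=
  forall z : R[i], eigenvalue (map_mx (real_complex R) M) z -> `|z| < 1.

Definition posdef n (M : 'M[R]_n) : Prop :=
  M^T = M /\ forall v : 'cV[R]_n, v != 0 -> 0 < (v^T *m M *m v) 0 0.

Definition possemidef n (M : 'M[R]_n) : Prop :=
  M^T = M /\ forall v : 'cV[R]_n, 0 <= (v^T *m M *m v) 0 0.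

Definition is_sqrtmx n (M S : 'M[R]_n) : Prop := possemidef S /\ S *m S = M.

Definition stabilizer (gamma : R) n m (A : 'M[R]_n) (B : 'M[R]_(n, m))
    (F : 'M[R]_(m, n)) : Prop :=
  schur (Num.sqrt gamma *: (A - B *m F)).

Definition stabilizable (gamma : R) n m (A : 'M[R]_n) (B : 'M[R]_(n, m)) :
    Prop :=
  exists F : 'M[R]_(m, n), stabilizer gamma A B F.

Definition detectable n p (M : 'M[R]_n) (C : 'M[R]_(p, n)) : Prop :=
  exists L : 'M[R]_(n, p), schur (M + L *m C).

(* Column stacking: entry (i, j) sits at position j * m + i, the indexing used by
   the Kronecker product *t. *)
Definition vec m n (M : 'M[R]_(m, n)) : 'cV[R]_(n * m) :=
  \col_k M (mxtens_unindex k).2 (mxtens_unindex k).1.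

Lemma tens_vec m n (x : 'cV[R]_n) (u : 'cV[R]_m) (M : 'M[R]_(m, n)) :
  (x^T *t u^T : 'rV_(n * m)) *m vec M = u^T *m M *m x.
Proof.
apply/matrixP => a b; rewrite !ord1 {a b} !mxE.
transitivity (\sum_(j < n) \sum_(i < m) x j 0 * u i 0 * M i j).
  rewrite pair_big /= (reindex (@mxtens_index n m)) /=; last first.
    exists (@mxtens_unindex n m) => k _.
      by rewrite mxtens_indexK.
    by rewrite mxtens_unindexK.
  by apply: eq_bigr => -[j i] _; rewrite !mxE mxtens_indexK /= !ord1.
apply: eq_bigr => j _; rewrite !mxE mulr_suml; apply: eq_bigr => i _.
by rewrite !mxE -mulrA mulrC.
Qed.

(* The pairs i <= j in the order (1,1), (1,2), ..., (1,p), (2,2), ..., (p,p). *)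
Definition upper_pairs p : seq ('I_p * 'I_p) :=
  [seq (i, j) | i : 'I_p <- enum 'I_p,
                j : 'I_p <- [seq j : 'I_p <- enum 'I_p | (i <= j)%N]].

Definition svec p (M : 'M[R]_p) : 'cV[R]_((p * p.+1)./2) :=
  \col_k [seq (if ij.1 == ij.2 then M ij.1 ij.2 else 2 * M ij.1 ij.2)
         | ij <- upper_pairs p]`_k.

Definition quadvec p (z : 'cV[R]_p) : 'cV[R]_((p * p.+1)./2) :=
  \col_k [seq z ij.1 0 * z ij.2 0 | ij <- upper_pairs p]`_k.

Lemma size_upper_pairs p : size (upper_pairs p) = (p * p.+1)./2.
Proof.
rewrite /upper_pairs size_allpairs_dep.
transitivity (\sum_(i < p) (p - i))%N.
  rewrite sumnE big_map big_enum /=; apply: eq_bigr => i _.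
  rewrite size_filter -(count_map val (fun k => i <= k)%N) val_enum_ord.
  have := iotaD 0 i (p - i); rewrite subnKC ?(ltnW (ltn_ord i)) // add0n => ->.
  rewrite count_cat.
  rewrite (_ : count _ (iota 0 i) = 0)%N; last first.
    apply/eqP; rewrite -leqn0 leqNgt -has_count; apply/hasPn => k.
    by rewrite mem_iota add0n /= -ltnNge.
  rewrite add0n -[RHS](size_iota i); apply/eqP; rewrite -all_count.
  by apply/allP => k; rewrite mem_iota => /andP[].
rewrite (reindex_inj rev_ord_inj) /=.
under eq_bigr => i _ do rewrite subKn //.
have := bin2_sum p.+1; rewrite big_mkord big_ord_recl add0n => ->.
by rewrite bin2 mulnC.
Qed.

Lemma quadvec_svec p (z : 'cV[R]_p) (M : 'M[R]_p) : M^T = M ->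
  (quadvec z)^T *m svec M = z^T *m M *m z.
Proof.
move=> symM; apply/matrixP => a b; rewrite !ord1 {a b} !mxE.
pose f (ij : 'I_p * 'I_p) := z ij.1 0 * z ij.2 0
  * (if ij.1 == ij.2 then M ij.1 ij.2 else 2 * M ij.1 ij.2).
transitivity (\sum_(ij <- upper_pairs p) f ij).
  case: p z M symM @f => [|p] z M symM f.
    by rewrite big_ord0 big1_seq // => -[[]].
  rewrite (big_nth (ord0, ord0)) size_upper_pairs big_mkord.
  apply: eq_bigr => k _.
  by rewrite !mxE !(nth_map (ord0, ord0)) ?size_upper_pairs.
transitivity (\sum_i \sum_j z i 0 * M i j * z j 0); last first.
  rewrite exchange_big; apply: eq_bigr => j _ /=.
  by rewrite !mxE mulr_suml; apply: eq_bigr => i _; rewrite !mxE.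
rewrite big_allpairs_dep big_enum /=.
under eq_bigr => i _ do rewrite big_filter big_enum_cond /=.
pose g i j := z i 0 * M i j * z j 0.
have gC i j : g i j = g j i.
  by rewrite /g -{1}symM mxE mulrC mulrA mulrAC.
have split i : \sum_j g i j =
    \sum_(j < p | (i < j)%N) g i j + \sum_(j < p | (j < i)%N) g i j + g i i.
  rewrite (bigID (fun j : 'I_p => (i < j)%N)) /= -addrA; congr (_ + _).
  rewrite (bigD1 i) ?ltnn //= addrC; congr (_ + _).
  by apply: eq_bigl => j; rewrite -leqNgt ltn_neqAle andbC.
rewrite (eq_bigr _ (fun i _ => split i)) !big_split /=.
have -> : \sum_(i < p) \sum_(j < p | (j < i)%N) g i j =
          \sum_(i < p) \sum_(j < p | (i < j)%N) g i j.
  rewrite (exchange_big_dep xpredT) //=.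
  by apply: eq_bigr => i _; apply: eq_bigr => j _; rewrite gC.
rewrite -!big_split /=; apply: eq_bigr => i _.
rewrite (bigD1 i) //= addrC /f /= eqxx; congr (_ + _); last first.
  by rewrite /g mulrAC.
rewrite -big_split /=; apply: eq_big => [j|j /andP[_ jNi]].
  by rewrite andbC ltn_neqAle (eq_sym j).
by rewrite eq_sym (negPf jNi) /g mulrCA mulr_natl mulrAC mulr2n.
Qed.

Section LQ.
Variables (gamma : R) (n m : nat).
Implicit Types (A Q P G Gam : 'M[R]_n) (B : 'M[R]_(n, m)) (Rw : 'M[R]_m).
Implicit Types (K : 'M[R]_(m, n)).

Definition Qgam Q Gam : 'M[R]_n := Gam^T *m Q *m Gam - Q *m Gam - Gam^T *m Q.

Definition riccati_gain A B Rw P : 'M[R]_(m, n) :=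
  gamma *: (invmx (Rw + gamma *: (B^T *m P *m B)) *m B^T *m P *m A).

Definition stabilizing_solution A B Q Rw P : Prop :=
  [/\ P^T = P,
      Rw + gamma *: (B^T *m P *m B) \in unitmx,
      P = gamma *: (A^T *m P *m A)
          - gamma ^+ 2 *: (A^T *m P *m B
              *m invmx (Rw + gamma *: (B^T *m P *m B)) *m B^T *m P *m A)
          + Q
    & stabilizer gamma A B (riccati_gain A B Rw P)].

Definition policy_iteration A G B Q Rw Gam K
    (Pi_ : nat -> 'M[R]_n) (Kb_ : nat -> 'M[R]_(m, n)) : Prop :=
  forall k,
    let Abar := A + G - B *m K - B *m Kb_ k in
    [/\ (Pi_ k)^T = Pi_ k,
        Pi_ k = gamma *: (Abar^T *m Pi_ k *m Abar)
                + (K + Kb_ k)^T *m Rw *m (K + Kb_ k) + Q + Qgam Q Gam,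
        Rw + gamma *: (B^T *m Pi_ k *m B) \in unitmx
      & Kb_ k.+1 = riccati_gain (A + G) B Rw (Pi_ k) - K].

Definition Hmx A B Q Rw P : 'M[R]_(n + m) :=
  block_mx (gamma *: (A^T *m P *m A) - P + Q) (gamma *: (A^T *m P *m B))
           (gamma *: (B^T *m P *m A)) (Rw + gamma *: (B^T *m P *m B)).

Definition both_stabilizable A G B : Prop :=
  stabilizable gamma A B /\ stabilizable gamma (A + G) B.

Definition detectability_condition A G Q Rw Gam : Prop :=
  [/\ possemidef Q, posdef Rw
    & exists sqrtQ, [/\ is_sqrtmx Q sqrtQ,
        detectable (Num.sqrt gamma *: A) sqrtQ
      & detectable (Num.sqrt gamma *: (A + G)) (sqrtQ *m (1%:M - Gam))]].

Definition lmi_condition A G B Q Rw Gam : Prop :=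
  exists P Pi : 'M[R]_n, [/\ P^T = P, Pi^T = Pi, posdef (Hmx A B Q Rw P)
    & posdef (Hmx (A + G) B (Q + Qgam Q Gam) Rw Pi)].

Definition Lambda2 B P : 'M[R]_m := gamma *: (B^T *m P *m B).

Definition regressor_row (Kk : 'M[R]_(m, n)) (x x' : 'cV[R]_n) (u : 'cV[R]_m) :
    'rV[R]_((n * n.+1)./2 + n * m + (m * m.+1)./2) :=
  row_mx (row_mx
    ((quadvec x)^T - gamma *: (quadvec x')^T)
    (2 *: (x^T *t u^T) + 2 *: ((x^T *t x^T) *m (1%:M *t Kk^T))))
    ((quadvec u)^T - (quadvec (Kk *m x))^T).

(* Row t (from 0) is built from the samples at times t + 1 and t + 2. *)
Definition regressor_mx l (Kk : 'M[R]_(m, n)) (xb : nat -> 'cV[R]_n)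
    (ub : nat -> 'cV[R]_m) :
    'M[R]_(l.-1, (n * n.+1)./2 + n * m + (m * m.+1)./2) :=
  \matrix_(t < l.-1) regressor_row Kk (xb t.+1) (xb t.+2) (ub t.+1).

Definition target_vec l (Qk : 'M[R]_n) (xb : nat -> 'cV[R]_n) : 'cV[R]_(l.-1) :=
  \col_(t < l.-1) ((quadvec (xb t.+1))^T *m svec Qk) 0 0.

Definition excitation_mx l (xb : nat -> 'cV[R]_n) (ub : nat -> 'cV[R]_m) :
    'M[R]_(l.-1, (n * n.+1)./2 + n * m + (m * m.+1)./2) :=
  \matrix_(t < l.-1)
    (row_mx (row_mx (quadvec (xb t.+1))^T ((xb t.+1)^T *t (ub t.+1)^T))
            (quadvec (ub t.+1))^T).

End LQ.
End Matrices.

Section Randomness.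
Context {d : measure_display} {T : measurableType d} {R : realType}.
Variable Pr : probability T R.

Definition vec_Lfun (p : \bar R) n (X : T -> 'cV[R]_n) : Prop :=
  forall j, (fun w => X w j 0) \in Lfun Pr p.

Definition vec_mean n (X : T -> 'cV[R]_n) : 'cV[R]_n :=
  \col_j fine ('E_Pr[fun om => X om j 0%R])%E.

Definition average N n (X : 'I_N -> T -> 'cV[R]_n) : T -> 'cV[R]_n :=
  fun w => N%:R^-1 *: \sum_i X i w.

Definition sigma_of I n (X : I -> T -> 'cV[R]_n) : set (set T) :=
  <<s \bigcup_(ij in @setT (I * 'I_n))
        preimage_set_system setT (fun w => X ij.1 w ij.2 0) measurable >>.

Definition mutually_independent (I : choiceType) n (X : I -> T -> 'cV[R]_n) :
    Prop :=
  forall (J : {fset I}) (E : I -> set T),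
    (forall i, i \in J -> sigma_of (fun _ : unit => X i) (E i)) ->
    Pr (\bigcap_(i in [set` J]) E i) = (\prod_(i <- J) Pr (E i))%E.

Definition independent_families I1 I2 n1 n2 (X : I1 -> T -> 'cV[R]_n1)
    (Y : I2 -> T -> 'cV[R]_n2) : Prop :=
  forall E F, sigma_of X E -> sigma_of Y F -> Pr (E `&` F) = (Pr E * Pr F)%E.

(* Variance sigma^2 is meant coordinatewise; the coordinates of one noise vector
   may be correlated. *)
Definition white_noise N q (sigma : R) (w : 'I_N -> nat -> T -> 'cV[R]_q) :
    Prop :=
  mutually_independent (fun it : 'I_N * nat => w it.1 it.2) /\
  forall i t, [/\ vec_Lfun 2%:E (w i t),
      forall j, ('E_Pr[fun om => w i t om j 0%R] = 0)%E
    & forall j, variance Pr (fun om => w i t om j 0) = (sigma ^+ 2)%:E].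

Definition initial_states N n q (x0 : 'I_N -> T -> 'cV[R]_n)
    (w : 'I_N -> nat -> T -> 'cV[R]_q) : Prop :=
  [/\ mutually_independent x0,
      independent_families x0 (fun it : 'I_N * nat => w it.1 it.2),
      forall i, vec_Lfun 2%:E (x0 i)
    & forall i i', vec_mean (x0 i) = vec_mean (x0 i')].

End Randomness.

(* Main.v *)
(** Up to the scaling [a = sqrt gamma (A + G)], [b = sqrt gamma B], the iteration
    is Kleinman's: [Pi_k] is the cost of the gain [L_k = K + Kb_k], and [L_{k+1}]
    is greedy for [Pi_k].  Either standing assumption yields
    [W = Rw + gamma B^T Pi B > 0] at the stabilizing solution [Pi], with optimal
    gain [L].  Completing the square in the policy cost then shows inductively that
    [a - b L_k] is Schur and [Pi_k >= Pi], and that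
    [Pi_{k+1} - Pi + (L - L_{k+1})^T W (L - L_{k+1})
       <= (a - b L)^T (Pi_k - Pi) (a - b L)].
    Since [a - b L] is Schur, both [Pi_k - Pi] and [L_{k+1} - L] tend to [0].

    For the least squares formula, taking expectations in the dynamics gives
    [xbar_{t+1} = (A + G) xbar_t + B ubar_t].  Hence the regressor applied to the
    unknowns [(X, Y, Z)] equals the excitation matrix applied to an invertible
    linear image of them, invertibility being that of the Lyapunov operator of
    the Schur matrix [a - b L_k]. *)

Require Import Defs.
From HB Require Import structures.
From mathcomp Require Import all_boot all_order all_algebra.
From mathcomp Require Import finmap complex mxtens.
From mathcomp Require Import all_classical all_reals all_analysis.
From mathcomp Require Import ring lra.

Import Order.TTheory GRing.Theory Num.Theory.
Import numFieldNormedType.Exports.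

Local Open Scope classical_set_scope.
Local Open Scope ring_scope.

Set Implicit Arguments.
Unset Strict Implicit.
Unset Printing Implicit Defensive.

(** * Geometric decay of the powers of a Schur matrix *)

Section SchurPowers.
Context {C : numClosedFieldType}.

(** The constant [e = |y 0| + c / (r - r0)] satisfies [r0 * e + c <= r * e], so the bound
    [e * r ^+ k] reproduces itself along the recurrence. *)
Lemma geometric_recurrence (z r0 r c : C) (y f : nat -> C) :
  `|z| <= r0 -> r0 < r -> 0 <= c ->
  (forall k, y k.+1 = z * y k + f k) -> (forall k, `|f k| <= c * r ^+ k) ->
  forall k, `|y k| <= (`|y 0%N| + c / (r - r0)) * r ^+ k.
Proof.
move=> zr0 r0r c0 yE fb; have d0 : 0 < r - r0 by rewrite subr_gt0.
have r0_0 : 0 <= r0 by exact: le_trans zr0.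
have r_0 : 0 <= r by exact/ltW/(le_lt_trans _ r0r).
elim=> [|k IH]; first by rewrite mulr1 lerDl divr_ge0 // ltW.
rewrite yE (le_trans (ler_normD _ _)) // normrM.
apply: (le_trans (lerD (ler_pM _ _ zr0 IH) (fb k))) => //.
rewrite -subr_ge0; set e := `|_| + _.
rewrite [X in 0 <= X](_ : _ = r ^+ k * (e * (r - r0) - c)); last first.
  by rewrite exprSr; ring.
rewrite mulr_ge0 ?exprn_ge0 // /e mulrDl divfK ?gt_eqF // addrK mulr_ge0 //.
exact: ltW.
Qed.

Lemma seq_norm_lt1_bound (s : seq C) : (forall z, z \in s -> `|z| < 1) ->
  exists r : C, [/\ 0 <= r, r < 1 & forall z, z \in s -> `|z| <= r].
Proof.
elim: s => [|z s IH] H; first by exists 0; split.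
case: IH => [y ys|r [r0 r1 rs]]; first by apply: H; rewrite inE ys orbT.
have z1 : `|z| < 1 by apply: H; rewrite inE eqxx.
have rzr : r >=< `|z| by rewrite real_comparable // ger0_real.
exists (Num.max r `|z|); split.
- by rewrite comparable_le_max // r0.
- by rewrite comparable_gt_max // r1.
move=> y; rewrite inE comparable_le_max // => /orP[/eqP->|/rs->//].
by rewrite lexx orbT.
Qed.

(** No Jordan form is involved: by Cayley-Hamilton the product of all factors [A - z%:M] vanishes.
    The factors are then stripped off one at a time, each removal being a scalar recurrence with
    multiplier [z] in every entry. *)
Lemma schur_powers_geometric n (A : 'M[C]_n) :
  (forall z, eigenvalue A z -> `|z| < 1) ->
  exists c r : C, [/\ 0 <= r, r < 1
    & forall k i j, `|(A ^+ k) i j| <= c * r ^+ k].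
Proof.
case: n A => [|n] A HA; first by exists 0, 0; split=> // k [].
have [s sE] := closed_field_poly_normal (char_poly A).
rewrite (monicP (char_poly_monic A)) scale1r in sE.
have s1 z : z \in s -> `|z| < 1.
  by move=> zs; apply: HA; rewrite eigenvalue_root_char sE root_prod_XsubC.
have [r0 [r0_ge0 r0_lt1 sr0]] := seq_norm_lt1_bound s1.
(* The rate lies strictly above every eigenvalue modulus, so the same [r] survives each removal
   whatever the multiplicities. *)
have [] := midf_lt r0_lt1; set r := _ / _ => r0r r1.
have prod0 : \prod_(z <- s) (A - z%:M) = 0.
  rewrite -[RHS](Cayley_Hamilton A) sE rmorph_prod; apply: eq_bigr => z _.
  by rewrite rmorphB /= horner_mx_X horner_mx_C.
(* Invariant of the induction on [s]: the powers of [A] times the remaining factors decay at rate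
   [r]. It starts from the full product, which is zero. *)
have : exists2 c, 0 <= c &
    forall k i j, `|(A ^+ k * \prod_(z <- s) (A - z%:M)) i j| <= c * r ^+ k.
  by exists 0 => // k i j; rewrite prod0 mulr0 mxE normr0 mul0r.
elim: s sr0 {sE s1 prod0} => [|z s IH] sr0 [c c0 cb].
  exists c, r; split=> [||k i j] //; first exact/ltW/(le_lt_trans _ r0r).
  by have := cb k i j; rewrite big_nil mulr1.
apply: IH => [y ys|]; first by apply: sr0; rewrite inE ys orbT.
set W := \prod_(z <- s) _ in cb *.
have W0 i j : 0 <= `|W i j| + c / (r - r0).
  by rewrite addr_ge0 // divr_ge0 // subr_ge0 ltW.
(* Summing the entrywise constants gives one that serves all entries. *)
exists (\sum_i \sum_j (`|W i j| + c / (r - r0))) => [|k i j].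
  by apply: sumr_ge0 => i _; apply: sumr_ge0.
apply: (@le_trans _ _ ((`|W i j| + c / (r - r0)) * r ^+ k)).
  have := @geometric_recurrence z r0 r c (fun k => (A ^+ k * W) i j)
    (fun k => (A ^+ k * ((A - z%:M) * W)) i j).
  rewrite expr0 mul1r; apply=> // [|l|l].
  - by apply: sr0; rewrite inE eqxx.
  - rewrite (_ : A ^+ l.+1 * W = z *: (A ^+ l * W) + A ^+ l * ((A - z%:M) * W)).
      by rewrite !mxE.
    rewrite mulrBl mulrBr mulrA -exprSr -!mulmxE mul_scalar_mx -scalemxAr.
    by rewrite addrC subrK.
  - by have := cb l i j; rewrite big_cons.
rewrite ler_wpM2r ?exprn_ge0 //; first exact/ltW/(le_lt_trans _ r0r).
rewrite (bigD1 i) //= (bigD1 j) //= -addrA lerDl.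
by rewrite addr_ge0 //; do ?[apply: sumr_ge0 => ? _].
Qed.

End SchurPowers.

Section SchurReal.
Context {R : realType}.
Implicit Types (n : nat).

Lemma schur_powers_cvg0 n (A : 'M[R]_n) : schur A ->
  forall i j, (A ^+ k) i j @[k --> \oo] --> (0 : R).
Proof.
move=> /schur_powers_geometric[c [r [r0 r1 H]]] i j.
have c0 : 0 <= c by have := H 0%N i j; rewrite mulr1; apply: le_trans.
(* In the order on [R[i]], being nonnegative includes being real, so both constants descend to
   [R]. *)
have [c' cE] : exists c', c = real_complex R c'.
  by exists (complex.Re c); rewrite RRe_real // ger0_real.
have [r' rE] : exists r', r = real_complex R r'.
  by exists (complex.Re r); rewrite RRe_real // ger0_real.
rewrite {c}cE {r}rE ler0c in H r0 r1 c0.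
have bnd k : `|(A ^+ k) i j| <= c' * r' ^+ k.
  have := H k i j; rewrite -rmorphXn /= mxE -rmorphXn -rmorphM /=.
  by rewrite normc_def /= expr0n /= addr0 sqrtr_sqr lecR.
have gr : geometric c' r' x @[x --> \oo] --> (0 : R).
  apply: cvg_geometric; by rewrite ger0_norm // -ltcR.
apply: norm_cvg0; apply: (squeeze_cvgr _ _ gr); last exact: cvg_cst.
by apply: nearW => k; rewrite normr_ge0 /= bnd.
Qed.

End SchurReal.

(** * The Schur property in terms of real vectors *)

Section ComplexMatrices.
Context {R : realType}.

Definition complex_mx n p (x y : 'M[R]_(n, p)) : 'M[R[i]]_(n, p) :=
  \matrix_(i, j) Complex (x i j) (y i j).

Lemma complex_mx_inj n p (x y x' y' : 'M[R]_(n, p)) :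
  complex_mx x y = complex_mx x' y' -> x = x' /\ y = y'.
Proof.
move=> /matrixP E; split; apply/matrixP => i j;
  by have := E i j; rewrite !mxE => -[].
Qed.

Lemma complex_mxP n p (v : 'M[R[i]]_(n, p)) : exists x y, v = complex_mx x y.
Proof.
exists (map_mx (@complex.Re R) v), (map_mx (@complex.Im R) v).
by apply/matrixP => i j; rewrite !mxE; case: (v i j).
Qed.

Lemma mul_real_complex_mx n p r (M : 'M[R]_(n, p)) (x y : 'M[R]_(p, r)) :
  map_mx (real_complex R) M *m complex_mx x y = complex_mx (M *m x) (M *m y).
Proof.
apply/matrixP => i j; rewrite !mxE.
elim/big_rec3: _ => //= k c c' z _ ->; rewrite !mxE.
by apply/eqP; rewrite eq_complex /= !mul0r subr0 addr0 !eqxx.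
Qed.

Lemma scale_complex_mx n p (a b : R) (x y : 'M[R]_(n, p)) :
  Complex a b *: complex_mx x y
  = complex_mx (a *: x - b *: y) (b *: x + a *: y).
Proof.
apply/matrixP => i j; rewrite !mxE.
by apply/eqP; rewrite eq_complex /= addrC !eqxx addrC eqxx.
Qed.

(** [eigenvalue] refers to row eigenvectors; this passes to the column vectors on which the closed
    loop acts. *)
Lemma eigenvalue_trmx n (A : 'M[R[i]]_n) z : eigenvalue A^T z = eigenvalue A z.
Proof.
rewrite !eigenvalue_root_char /char_poly -[in RHS]det_tr; congr (root (\det _) _).
by apply/matrixP => i j; rewrite !mxE eq_sym.
Qed.

(* Real form of the eigenvalue equation [A (p + i q) = (a + i b) (p + i q)]. *)
Lemma schurP n (A : 'M[R]_n) : schur A <->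
  forall (a b : R) (p q : 'cV[R]_n),
    A *m p = a *: p - b *: q -> A *m q = b *: p + a *: q ->
    1 <= a ^+ 2 + b ^+ 2 -> p = 0 /\ q = 0.
Proof.
have norm_lt1 a b : (`|Complex a b| < 1 :> R[i]) = (a ^+ 2 + b ^+ 2 < 1 :> R).
  rewrite normc_def (ltcR _ 1) /= -[X in _ < X]sqrtr1.
  by rewrite ltr_sqrt.
have cmx0 : complex_mx (0 : 'cV[R]_n) 0 = 0 by apply/matrixP => i j; rewrite !mxE.
split=> [sA a b p q Ap Aq ab|H [a b]].
  apply: complex_mx_inj; rewrite cmx0; apply/eqP/negPn/negP => pq0.
  have : `|Complex a b| < 1 :> R[i].
    apply: sA; rewrite -eigenvalue_trmx; apply/eigenvalueP.
    exists (complex_mx p q)^T; last by rewrite trmx_eq0.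
    by rewrite -trmx_mul mul_real_complex_mx -linearZ /= scale_complex_mx Ap Aq.
  by rewrite norm_lt1 ltNge ab.
rewrite -eigenvalue_trmx => /eigenvalueP[v].
rewrite -[v]trmxK; have [p [q ->]] := complex_mxP v^T.
rewrite -trmx_mul mul_real_complex_mx -linearZ /= scale_complex_mx.
move=> /trmx_inj/complex_mx_inj[Ap Aq] pq0; rewrite norm_lt1 ltNge.
apply/negP => /(H _ _ _ _ Ap Aq)[p0 q0].
by move: pq0; rewrite p0 q0 cmx0 trmx0 eqxx.
Qed.

End ComplexMatrices.

(** * Bilinear forms and Lyapunov inequalities *)

Section QuadraticForms.
Context {R : realType}.

(** Scalar-valued, so that matrix identities and inequalities become goals for [ring] and [lra]. *)
Definition bform n p (X : 'M[R]_(n, p)) (u : 'cV[R]_n) (v : 'cV[R]_p) : R :=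
  (u^T *m X *m v) 0 0.

Lemma bformDl n p (X : 'M[R]_(n, p)) u u' v :
  bform X (u + u') v = bform X u v + bform X u' v.
Proof. by rewrite /bform linearD /= !mulmxDl mxE. Qed.

Lemma bformDr n p (X : 'M[R]_(n, p)) u v v' :
  bform X u (v + v') = bform X u v + bform X u v'.
Proof. by rewrite /bform mulmxDr mxE. Qed.

Lemma bformZl n p (X : 'M[R]_(n, p)) c u v :
  bform X (c *: u) v = c * bform X u v.
Proof. by rewrite /bform linearZ /= -!scalemxAl mxE. Qed.

Lemma bformZr n p (X : 'M[R]_(n, p)) c u v :
  bform X u (c *: v) = c * bform X u v.
Proof. by rewrite /bform -scalemxAr mxE. Qed.

Lemma bformBl n p (X : 'M[R]_(n, p)) u u' v :
  bform X (u - u') v = bform X u v - bform X u' v.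
Proof. by rewrite bformDl -scaleN1r bformZl mulN1r. Qed.

Lemma bformBr n p (X : 'M[R]_(n, p)) u v v' :
  bform X u (v - v') = bform X u v - bform X u v'.
Proof. by rewrite bformDr -scaleN1r bformZr mulN1r. Qed.

Definition bformE := (bformBl, bformBr, bformDl, bformDr, bformZl, bformZr).

Lemma bform_addmx n p (X Y : 'M[R]_(n, p)) u v :
  bform (X + Y) u v = bform X u v + bform Y u v.
Proof. by rewrite /bform mulmxDr mulmxDl mxE. Qed.

Lemma bform_scalemx n p c (X : 'M[R]_(n, p)) u v :
  bform (c *: X) u v = c * bform X u v.
Proof. by rewrite /bform -scalemxAr -scalemxAl mxE. Qed.

Lemma bform_oppmx n p (X : 'M[R]_(n, p)) u v : bform (- X) u v = - bform X u v.
Proof. by rewrite -scaleN1r bform_scalemx mulN1r. Qed.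

Lemma bform_submx n p (X Y : 'M[R]_(n, p)) u v :
  bform (X - Y) u v = bform X u v - bform Y u v.
Proof. by rewrite bform_addmx bform_oppmx. Qed.

Lemma bform_mull n n' p (X : 'M[R]_(n, p)) (C : 'M[R]_(n, n')) u v :
  bform (C^T *m X) u v = bform X (C *m u) v.
Proof. by rewrite /bform trmx_mul !mulmxA. Qed.

Lemma bform_mulr n p p' (X : 'M[R]_(n, p)) (C : 'M[R]_(p, p')) u v :
  bform (X *m C) u v = bform X u (C *m v).
Proof. by rewrite /bform !mulmxA. Qed.

Lemma bform_congr n p n' p' (X : 'M[R]_(n, p)) (C : 'M[R]_(n, n'))
    (E : 'M[R]_(p, p')) u v :
  bform (C^T *m X *m E) u v = bform X (C *m u) (E *m v).
Proof. by rewrite bform_mulr bform_mull. Qed.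

Lemma bform_trmx n p (X : 'M[R]_(n, p)) u v : bform X^T u v = bform X v u.
Proof.
rewrite /bform; transitivity ((v^T *m X *m u)^T 0 0); last by rewrite [LHS]mxE.
by rewrite !trmx_mul trmxK mulmxA.
Qed.

Lemma bformC n (X : 'M[R]_n) u v : X^T = X -> bform X u v = bform X v u.
Proof. by move=> sX; rewrite -bform_trmx sX. Qed.

Definition bform_mxE := (bform_addmx, bform_oppmx, bform_scalemx, bform_mull,
  bform_mulr, bform_trmx).

Lemma bform_delta n (X : 'M[R]_n) i j :
  bform X (delta_mx i 0) (delta_mx j 0) = X i j.
Proof. by rewrite /bform trmx_delta -rowE -colE !mxE. Qed.

Lemma bform0l n p (X : 'M[R]_(n, p)) v : bform X 0 v = 0.
Proof. by rewrite /bform trmx0 !mul0mx mxE. Qed.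

(* Cauchy-Schwarz, from the form at [bform X v v *: u - bform X u v *: v]. *)
Lemma bform_CauchySchwarz n (X : 'M[R]_n) u v : posdef X ->
  bform X u v ^+ 2 <= bform X u u * bform X v v.
Proof.
move=> [sX X0]; have [->|v0] := eqVneq v 0.
  by rewrite (bformC _ _ sX) !bform0l expr0n mulr0.
have s0 := X0 _ v0; rewrite -/(bform X v v) in s0.
set s := bform X v v in s0 *; set c := bform X u v.
have : 0 <= bform X (s *: u - c *: v) (s *: u - c *: v).
  have [->|w0] := eqVneq (s *: u - c *: v) 0; first by rewrite bform0l.
  exact/ltW/X0.
rewrite !bformE -/s -/c (bformC v u sX) -/c.
rewrite [X in 0 <= X](_ : _ = s * (bform X u u * s - c ^+ 2)); last by ring.
by rewrite pmulr_rge0 // subr_ge0.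
Qed.

Lemma cvgr_sum (I : Type) (s : seq I) (f : I -> nat -> R) (l : I -> R) :
  (forall i, f i k @[k --> \oo] --> l i) ->
  \sum_(i <- s) f i k @[k --> \oo] --> \sum_(i <- s) l i.
Proof.
move=> H; elim: s => [|i s IH].
  by rewrite big_nil; under eq_cvg do rewrite big_nil; exact: cvg_cst.
by rewrite big_cons; under eq_cvg do rewrite big_cons; exact: cvgD.
Qed.

Lemma bform_block n1 n2 p1 p2 (X1 : 'M[R]_(n1, p1)) (X2 : 'M[R]_(n1, p2))
    (X3 : 'M[R]_(n2, p1)) (X4 : 'M[R]_(n2, p2)) u1 u2 v1 v2 :
  bform (block_mx X1 X2 X3 X4) (col_mx u1 u2) (col_mx v1 v2)
  = bform X1 u1 v1 + bform X2 u1 v2 + bform X3 u2 v1 + bform X4 u2 v2.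
Proof.
rewrite /bform tr_col_mx mul_row_block mul_row_col !mulmxDl !mxE.
by rewrite addrACA !addrA.
Qed.

Lemma bform_sumE n (X : 'M[R]_n) u v :
  bform X u v = \sum_i \sum_j u i 0 * X i j * v j 0.
Proof.
rewrite /bform mxE exchange_big; apply: eq_bigr => j _.
by rewrite !mxE mulr_suml; apply: eq_bigr => i _; rewrite mxE.
Qed.

Lemma bform_powers_cvg0 n (A X : 'M[R]_n) v : schur A ->
  bform X (A ^+ k *m v) (A ^+ k *m v) @[k --> \oo] --> (0 : R).
Proof.
move=> /schur_powers_cvg0 H.
have Hv i : (A ^+ k *m v) i 0 @[k --> \oo] --> (0 : R).
  rewrite (_ : 0 = \sum_(j < n) 0 * v j 0); last first.
    by rewrite big1 // => j _; rewrite mul0r.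
  under eq_cvg do rewrite mxE.
  apply: cvgr_sum => j; apply: cvgM (H i j) _; exact: cvg_cst.
rewrite (_ : 0 = \sum_(i < n) \sum_(j < n) 0 * X i j * 0); last first.
  by rewrite big1 // => i _; rewrite big1 // => j _; rewrite mulr0.
under eq_cvg do rewrite bform_sumE.
apply: cvgr_sum => i; apply: cvgr_sum => j; apply: cvgM (Hv j).
by apply: cvgM (Hv i) _; exact: cvg_cst.
Qed.

(** Along the orbit [A ^+ k *m v] the form does not increase, and it tends to 0 because [A] is
    Schur; its initial value is therefore at least 0. *)
Lemma lyapunov_ge0 n (A X : 'M[R]_n) : schur A ->
  (forall v, bform X (A *m v) (A *m v) <= bform X v v) ->
  forall v, 0 <= bform X v v.
Proof.
move=> sA H v.
have dec k : bform X (A ^+ k *m v) (A ^+ k *m v) <= bform X v v.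
  elim: k => [|k IH]; first by rewrite expr0 mul1mx.
  by rewrite exprS -mulmxE -mulmxA (le_trans (H _)).
rewrite -(cvg_lim _ (bform_powers_cvg0 X v sA)) //.
apply: limr_le; first by apply/cvg_ex; exists 0; exact: bform_powers_cvg0.
exact: nearW.
Qed.

(** Polarization at sums of two basis vectors. *)
Lemma bform_eq0 n (X : 'M[R]_n) : X^T = X ->
  (forall v, bform X v v = 0) -> X = 0.
Proof.
move=> sX X0; apply/matrixP => i j; rewrite mxE -bform_delta.
have := X0 (delta_mx i 0 + delta_mx j 0); rewrite !bformE !X0.
by rewrite (bformC (delta_mx j 0) _ sX) => ?; lra.
Qed.

(** The Lyapunov inequality holds for both [X] and [- X]. *)
Lemma lyapunov_eq0 n (A X : 'M[R]_n) : schur A -> X^T = X ->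
  (forall v, bform X (A *m v) (A *m v) = bform X v v) -> X = 0.
Proof.
move=> sA sX E; apply: bform_eq0 => // v; apply/eqP; rewrite eq_le.
apply/andP; split.
  rewrite -oppr_ge0 -mulN1r -bform_scalemx; apply: (lyapunov_ge0 sA) => w.
  by rewrite !bform_scalemx E.
by apply: (lyapunov_ge0 sA) => w; rewrite E.
Qed.

End QuadraticForms.

(** * Bellman operators and one step of policy iteration *)

Section PolicyImprovement.
Context {R : realType} (n m : nat).
Variables (a : 'M[R]_n) (b : 'M[R]_(n, m)) (S : 'M[R]_m) (q : 'M[R]_n).
Hypothesis S_sym : S^T = S.
Implicit Types (X : 'M[R]_n) (L : 'M[R]_(m, n)) (v : 'cV[R]_n).

(** The Bellman operator of the gain [L]: stage cost at [v] under the input [- L *m v], plus the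
    continuation cost [X] at the next state. *)
Definition policy_cost X L v : R :=
  bform X ((a - b *m L) *m v) ((a - b *m L) *m v)
  + bform S (L *m v) (L *m v) + bform q v v.

Definition input_weight X : 'M[R]_m := S + b^T *m X *m b.

(** The stationarity condition for minimizing the Bellman cost over the gain, written without an
    inverse. *)
Definition greedy X L : Prop := input_weight X *m L = b^T *m X *m a.

(** Completing the square around the stationary gain [L]: the greedy equation cancels the terms
    linear in [L' - L]. *)
Lemma policy_cost_square X L L' v : X^T = X -> greedy X L ->
  policy_cost X L' v
  = policy_cost X L v + bform (input_weight X) ((L' - L) *m v) ((L' - L) *m v).
Proof.
move=> sX gX.
have WE l l' : bform (input_weight X) l l' = bform S l l' + bform X (b *m l) (b *m l').
  by rewrite bform_addmx bform_congr.
have gE l : bform S l (L *m v) + bform X (b *m l) (b *m (L *m v))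
          = bform X (b *m l) (a *m v).
  rewrite -WE /bform mulmxA -(mulmxA _ _ L) gX trmx_mul.
  by rewrite !mulmxA.
have := gE (L *m v); have := gE (L' *m v).
rewrite /policy_cost WE !mulmxBl !mulmxBr -!mulmxA !bformE.
rewrite (bformC (a *m v) (b *m _) sX) (bformC (a *m v) (b *m (L *m v)) sX).
rewrite (bformC (L *m v) (L' *m v) S_sym).
rewrite (bformC (b *m (L *m v)) (b *m (L' *m v)) sX).
by move=> *; lra.
Qed.

Variables (X0 : 'M[R]_n) (L0 : 'M[R]_(m, n)).
Hypotheses (X0_sym : X0^T = X0) (X0_greedy : greedy X0 L0)
  (X0E : forall v, bform X0 v v = policy_cost X0 L0 v)
  (L0_schur : schur (a - b *m L0)) (W0 : posdef (input_weight X0)).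

Lemma input_weight_ge0 w : 0 <= bform (input_weight X0) w w.
Proof.
have [->|w0] := eqVneq w 0; first by rewrite bform0l.
exact/ltW/(proj2 W0).
Qed.

Lemma input_weight_eq0 w : bform (input_weight X0) w w <= 0 -> w = 0.
Proof.
move=> H; apply/eqP/negPn/negP => /(proj2 W0).
by rewrite -/(bform _ _ _) ltNge H.
Qed.

Lemma input_weight_mono X w : (forall v, bform X0 v v <= bform X v v) ->
  bform (input_weight X0) w w <= bform (input_weight X) w w.
Proof. by move=> H; rewrite !bform_addmx !bform_congr lerD2l. Qed.

Section Step.
Variables (X : 'M[R]_n) (L L' : 'M[R]_(m, n)).
Hypotheses (X_sym : X^T = X) (L_schur : schur (a - b *m L))
  (XE : forall v, bform X v v = policy_cost X L v) (XL' : greedy X L').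

Lemma policy_cost_diff Y Z K v : policy_cost Y K v - policy_cost Z K v =
  bform Y ((a - b *m K) *m v) ((a - b *m K) *m v)
  - bform Z ((a - b *m K) *m v) ((a - b *m K) *m v).
Proof. by rewrite /policy_cost; ring. Qed.

(** For the optimal pair, completing the square gives [policy_cost X0 L0 <= policy_cost X0 L]. Hence
    [X - X0] satisfies the Lyapunov inequality of the Schur matrix [a - b *m L]. *)
Lemma policy_value_ge v : bform X0 v v <= bform X v v.
Proof.
rewrite -subr_ge0 -bform_submx; move: v; apply: (lyapunov_ge0 L_schur) => v.
rewrite !bform_submx -policy_cost_diff XE X0E lerD2l lerN2.
by rewrite (policy_cost_square L v X0_sym X0_greedy) lerDl input_weight_ge0.
Qed.

(** The stationary gain [L'] is a minimizer because the weight at [X] dominates the positive weight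
    at [X0]. *)
Lemma policy_improvement v : policy_cost X L' v <= bform X v v.
Proof.
rewrite XE (policy_cost_square L v X_sym XL') lerDl.
exact: le_trans (input_weight_ge0 _) (input_weight_mono _ policy_value_ge).
Qed.

(* On a closed-loop eigenvector of modulus at least 1 the Lyapunov decrease
   forces [L'] to agree with the optimal gain [L0], which is stabilizing. *)
Lemma greedy_schur : schur (a - b *m L').
Proof.
apply/schurP => c d p r Ep Er cd.
pose D v := bform (input_weight X0) ((L' - L0) *m v) ((L' - L0) *m v).
have D0 v : 0 <= D v by exact: input_weight_ge0.
have dec v : bform (X - X0) ((a - b *m L') *m v) ((a - b *m L') *m v) + D v
             <= bform (X - X0) v v.
  have := policy_improvement v; have := policy_cost_diff X X0 L' v.
  have := policy_cost_square L' v X0_sym X0_greedy.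
  by rewrite !bform_submx -X0E -/(D v) => *; lra.
have := dec p; have := dec r; rewrite Ep Er.
have pr0 v : 0 <= bform (X - X0) v v.
  by rewrite bform_submx subr_ge0 policy_value_ge.
have := pr0 p; have := pr0 r.
have sXX : (X - X0)^T = X - X0 by rewrite linearB /= X_sym X0_sym.
rewrite !bformE (bformC r p sXX).
set x := bform _ p p; set y := bform _ r r; set z := bform _ p r => y0 x0 Hr Hp.
(* Adding the decrease at [p] and at [r] cancels the mixed terms in [z]: the closed loop multiplies
   [x + y] by [c ^+ 2 + d ^+ 2]. *)
have H : (c ^+ 2 + d ^+ 2 - 1) * (x + y) + D p + D r <= 0.
  by move: Hp Hr; lra.
have H' : 0 <= (c ^+ 2 + d ^+ 2 - 1) * (x + y).
  by rewrite mulr_ge0 ?subr_ge0 ?addr_ge0.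
(* Vanishing of [D] makes [p] and [r] solve the same eigenvalue equation for the optimal closed
   loop, which is Schur. *)
have agree v : D v <= 0 -> (a - b *m L') *m v = (a - b *m L0) *m v.
  move=> /input_weight_eq0; rewrite mulmxBl => /subr0_eq E.
  by rewrite !mulmxBl -!mulmxA E.
have Dp : D p <= 0 by have := D0 r; lra.
have Dr : D r <= 0 by have := D0 p; lra.
by have /schurP/(_ c d p r) := L0_schur; rewrite -!agree //; apply.
Qed.

Variable X' : 'M[R]_n.
Hypothesis X'E : forall v, bform X' v v = policy_cost X' L' v.

(** The right side is [policy_cost X L0 v] minus the optimal value. Completing the square around
    [L'] splits off the gain error, and [X' <= X] bounds the remaining [policy_cost X L' v] below by
    the new value. *)
Lemma policy_iteration_contract v :
  bform X' v v - bform X0 v v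
    + bform (input_weight X0) ((L0 - L') *m v) ((L0 - L') *m v)
  <= bform X ((a - b *m L0) *m v) ((a - b *m L0) *m v)
     - bform X0 ((a - b *m L0) *m v) ((a - b *m L0) *m v).
Proof.
have X'X w : bform X' w w <= bform X w w.
  rewrite -subr_ge0 -bform_submx; move: w; apply: (lyapunov_ge0 greedy_schur) => w.
  rewrite !bform_submx -policy_cost_diff -X'E lerD2r.
  exact: policy_improvement.
rewrite -policy_cost_diff -X0E (policy_cost_square L0 v X_sym XL').
rewrite addrAC lerD2r lerD //; last exact/input_weight_mono/policy_value_ge.
by rewrite X'E -subr_ge0 policy_cost_diff subr_ge0.
Qed.

End Step.

(** * Convergence of the values and of the gains *)

Section Sequence.
Variables (X : nat -> 'M[R]_n) (L : nat -> 'M[R]_(m, n)).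
Hypotheses (X_sym : forall k, (X k)^T = X k)
  (XE : forall k v, bform (X k) v v = policy_cost (X k) (L k) v)
  (XL : forall k, greedy (X k) (L k.+1))
  (Lini_schur : schur (a - b *m L 0%N)).

Lemma policy_iteration_schur k : schur (a - b *m L k).
Proof. elim: k => [|k IH]; first exact: Lini_schur.
exact: (greedy_schur (X_sym k) IH (XE k) (XL k)). Qed.

Lemma policy_iteration_value_ge k v : bform X0 v v <= bform (X k) v v.
Proof. exact: policy_value_ge (@policy_iteration_schur k) (XE k) v. Qed.

Let contract k := policy_iteration_contract
  (X_sym k) (@policy_iteration_schur k) (XE k) (XL k) (XE k.+1).

Lemma policy_iteration_value_le k v :
  bform (X k) v v - bform X0 v v
  <= bform (X 0%N - X0) ((a - b *m L0) ^+ k *m v) ((a - b *m L0) ^+ k *m v).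
Proof.
elim: k v => [|k IH] v; first by rewrite expr0 mul1mx bform_submx.
rewrite exprSr -mulmxE -mulmxA (le_trans _ (IH _)) // (le_trans _ (contract k v)) //.
by rewrite lerDl input_weight_ge0.
Qed.

Lemma bform_value_cvg v : bform (X k) v v - bform X0 v v @[k --> \oo] --> (0 : R).
Proof.
apply: (squeeze_cvgr _ _ (bform_powers_cvg0 (X 0%N - X0) v L0_schur)).
  2: exact: cvg_cst.
apply: nearW => k.
by rewrite subr_ge0 policy_iteration_value_ge policy_iteration_value_le.
Qed.

Lemma policy_value_cvg i j : X k i j @[k --> \oo] --> X0 i j.
Proof.
pose f v k := bform (X k) v v - bform X0 v v.
pose di : 'cV[R]_n := delta_mx i 0; pose dj : 'cV[R]_n := delta_mx j 0.
(* Polarization recovers an entry from the value gaps at three vectors. *)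
have E k : X k i j = X0 i j + 2^-1 * (f (di + dj) k - f di k - f dj k).
  rewrite /f -!bform_delta -/di -/dj !bformE.
  by rewrite (bformC dj di (X_sym k)) (bformC dj di X0_sym); field.
under eq_cvg do rewrite E.
have C : X0 i j + 2^-1 * (f (di + dj) k - f di k - f dj k) @[k --> \oo]
    --> X0 i j + 2^-1 * (0 - 0 - 0).
  apply: cvgD; first exact: cvg_cst.
  apply: cvgM; first exact: cvg_cst.
  by apply: cvgB; [apply: cvgB|]; exact: bform_value_cvg.
by move: C; rewrite !subr0 mulr0 addr0.
Qed.

(** The gain error in the contraction inequality is squeezed below the value gap at
    [(a - b *m L0) *m v]. *)
Lemma bform_gain_cvg v :
  bform (input_weight X0) ((L0 - L k.+1) *m v) ((L0 - L k.+1) *m v) @[k --> \oo]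
  --> (0 : R).
Proof.
apply: (squeeze_cvgr _ _ (bform_value_cvg ((a - b *m L0) *m v))).
  2: exact: cvg_cst.
apply: nearW => k; rewrite input_weight_ge0 (le_trans _ (contract k v)) //.
by rewrite lerDr subr_ge0 policy_iteration_value_ge.
Qed.

Lemma policy_gain_cvg i j : input_weight X0 \in unitmx ->
  L k i j @[k --> \oo] --> L0 i j.
Proof.
(* The initial gain need not be greedy for anything, so the index is shifted past it. *)
move=> uW; rewrite -(cvg_shiftS (fun k => L k i j)) /=.
pose W := input_weight X0.
(* Cauchy-Schwarz for the weight [W], with a basis vector on the left, bounds the square of this
   entry by a multiple of the gain error. Multiplying by [invmx W] below isolates the gain
   itself. *)
have WD r s : (W *m (L0 - L k.+1)) r s @[k --> \oo] --> (0 : R).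
  apply: norm_cvg0.
  have sq : `|(W *m (L0 - L k.+1)) r s| ^+ 2 @[k --> \oo] --> (0 : R).
    have C : bform W (delta_mx r 0) (delta_mx r 0)
        * bform W ((L0 - L k.+1) *m delta_mx s 0) ((L0 - L k.+1) *m delta_mx s 0)
        @[k --> \oo] --> bform W (delta_mx r 0) (delta_mx r 0) * 0.
      by apply: cvgM (bform_gain_cvg _); exact: cvg_cst.
    rewrite mulr0 in C; apply: (squeeze_cvgr _ _ C); last exact: cvg_cst.
    apply: nearW => k; rewrite sqr_ge0 real_normK ?num_real //=.
    rewrite -[X in X ^+ 2 <= _](_ :
        bform W (delta_mx r 0) ((L0 - L k.+1) *m delta_mx s 0) = _).
      exact: bform_CauchySchwarz.
    by rewrite /bform mulmxA -(mulmxA _ W) trmx_delta -rowE -colE !mxE.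
  have : Num.sqrt (`|(W *m (L0 - L k.+1)) r s| ^+ 2) @[k --> \oo] --> Num.sqrt 0.
    exact: (continuous_cvg _ (@sqrt_continuous R 0) sq).
  by rewrite sqrtr0; under eq_cvg do rewrite sqrtr_sqr normr_id.
have E k : L k.+1 i j = L0 i j - \sum_r invmx W i r * (W *m (L0 - L k.+1)) r j.
  have : (L0 - L k.+1) i j = (invmx W *m (W *m (L0 - L k.+1))) i j.
    by rewrite mulKmx.
  by rewrite mxE [X in _ = X]mxE => <-; rewrite mxE; ring.
under eq_cvg do rewrite E.
have C : L0 i j - \sum_r invmx W i r * (W *m (L0 - L k.+1)) r j @[k --> \oo]
    --> L0 i j - \sum_r invmx W i r * 0.
  apply: cvgB; first exact: cvg_cst.
  by apply: cvgr_sum => r; apply: cvgM (WD r j); exact: cvg_cst.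
by move: C; rewrite [X in _ - X]big1 ?subr0 // => r _; rewrite mulr0.
Qed.

End Sequence.
End PolicyImprovement.

(** * Half-vectorization, Gram matrices and injectivity of the regressor *)

Section LeastSquares.
Context {R : realType}.

Lemma mem_upper_pairs p (i j : 'I_p) : ((i, j) \in upper_pairs p) = (i <= j)%N.
Proof.
apply/allpairsPdep/idP => [[i' [j' [_]]]|ij].
  by rewrite mem_filter => /andP[ij' _] [-> ->].
exists i, j; split; [exact: mem_enum| |by []].
by rewrite mem_filter ij; exact: mem_enum.
Qed.

Lemma uniq_upper_pairs p : uniq (upper_pairs p).
Proof.
apply: allpairs_uniq_dep => [|i _|[i j] [i' j'] _ _ /= [-> ->] //].
  exact: enum_uniq.
exact/filter_uniq/enum_uniq.
Qed.

Lemma svec_eq0 p (M : 'M[R]_p) : M^T = M -> svec M = 0 -> M = 0.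
Proof.
move=> sM M0.
have upper (i j : 'I_p) : (i <= j)%N -> M i j = 0.
  rewrite -mem_upper_pairs => ij.
  have kP : (index (i, j) (upper_pairs p) < (p * p.+1)./2)%N.
    by rewrite -size_upper_pairs index_mem.
  have /matrixP/(_ (Ordinal kP) 0) := M0.
  rewrite !mxE /= (nth_map (i, j)) ?index_mem // nth_index //=.
  case: ifP => // _ /eqP; rewrite mulf_eq0 pnatr_eq0 /= => /eqP.
  by [].
apply/matrixP => i j; rewrite mxE; have [/upper//|/ltnW/upper] := leqP i j.
by rewrite -[in M j i]sM mxE.
Qed.

Lemma svec_surj p (y : 'cV[R]_((p * p.+1)./2)) :
  exists2 M : 'M[R]_p, M^T = M & svec M = y.
Proof.
pose s := [seq y k 0 | k <- enum 'I_((p * p.+1)./2)].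
pose pair (i j : 'I_p) := if (i <= j)%N then (i, j) else (j, i).
(* Off-diagonal entries are halved to undo the factor 2 in [svec]. *)
pose f (i j : 'I_p) : R := s`_(index (pair i j) (upper_pairs p))
  / (if i == j then 1 else 2).
exists (\matrix_(i, j) f i j).
  apply/matrixP => i j; rewrite !mxE /f eq_sym; congr (s`_(index _ _) / _).
  by rewrite /pair; case: ltngtP => // /val_inj ->.
apply/matrixP => k c; rewrite !mxE ord1 {c}.
have kp : (k < size (upper_pairs p))%N by rewrite size_upper_pairs.
have [i0 _] : exists i0 : 'I_p * 'I_p, True.
  by case: (upper_pairs p) kp => // ij; exists ij.
rewrite (nth_map i0) //; set ij := nth _ _ _.
have ijP : (ij.1 <= ij.2)%N.
  by rewrite -mem_upper_pairs -surjective_pairing mem_nth.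
have fE : f ij.1 ij.2 * (if ij.1 == ij.2 then 1 else 2) = y k 0.
  rewrite divfK; last by case: ifP; rewrite ?oner_eq0 ?pnatr_eq0.
  rewrite /pair ijP -surjective_pairing index_uniq ?uniq_upper_pairs //.
  by rewrite (nth_map k) ?size_enum_ord // nth_ord_enum.
by rewrite !mxE -fE; case: ifP; rewrite ?mulr1 // mulrC.
Qed.

Lemma svec0 p : svec (0 : 'M[R]_p) = 0.
Proof.
have [M sM M0] := svec_surj (0 : 'cV_((p * p.+1)./2)).
by rewrite -{1}(svec_eq0 sM M0).
Qed.

Lemma vec0 m n : vec (0 : 'M[R]_(m, n)) = 0.
Proof. by apply/matrixP => i j; rewrite !mxE. Qed.

Lemma vec_eq0 m n (M : 'M[R]_(m, n)) : vec M = 0 -> M = 0.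
Proof.
move=> /matrixP M0; apply/matrixP => i j.
by have := M0 (mxtens_index (j, i)) 0; rewrite !mxE mxtens_indexK.
Qed.

Lemma vec_surj m n (y : 'cV[R]_(n * m)) : exists M : 'M[R]_(m, n), vec M = y.
Proof.
exists (\matrix_(i, j) y (mxtens_index (j, i)) 0).
apply/matrixP => k c; rewrite !mxE ord1 -surjective_pairing.
by rewrite mxtens_unindexK.
Qed.

(** If [v] annihilates the Gram matrix, then the sum of squares of the entries of [M *m v^T] is
    zero, so [v^T] lies in the kernel of [M]. *)
Lemma unitmx_gram p r (M : 'M[R]_(p, r)) :
  (forall y : 'cV_r, M *m y = 0 -> y = 0) -> M^T *m M \in unitmx.
Proof.
move=> inj; rewrite -row_free_unit; apply: inj_row_free => v v0.
apply: trmx_inj; rewrite trmx0; apply: inj.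
have : (v *m (M^T *m M) *m v^T) 0 0 = 0 by rewrite v0 mul0mx mxE.
rewrite mulmxA -mulmxA -[v *m M^T]trmxK trmx_mul trmxK.
move: (M *m v^T) => z z0; apply/matrixP => i c; rewrite mxE ord1 {c}.
have /eqP : \sum_i z i 0 ^+ 2 = 0.
  by apply: etrans z0; rewrite [RHS]mxE; apply: eq_bigr => k _; rewrite mxE.
rewrite psumr_eq0 => [/allP/(_ i)|k _]; last exact: sqr_ge0.
by rewrite mem_index_enum sqrf_eq0 => /(_ isT)/eqP.
Qed.

Section Regressor.
Variables (gamma : R) (n m l : nat) (A : 'M[R]_n) (B : 'M[R]_(n, m)).
Variables (xb : nat -> 'cV[R]_n) (ub : nat -> 'cV[R]_m).
Hypothesis xbS : forall t, xb t.+1 = A *m xb t + B *m ub t.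
Implicit Types (X : 'M[R]_n) (Y L : 'M[R]_(m, n)) (Z : 'M[R]_m).

Definition unknowns X Y Z := col_mx (col_mx (svec X) (vec Y)) (svec Z).

Lemma quadvec_bform p (z : 'cV[R]_p) (M : 'M[R]_p) : M^T = M ->
  ((quadvec z)^T *m svec M) 0 0 = bform M z z.
Proof. by move=> sM; rewrite quadvec_svec. Qed.

Lemma tens_bform p r (x : 'cV[R]_p) (u : 'cV[R]_r) (M : 'M[R]_(r, p)) :
  ((x^T *t u^T : 'rV_(p * r)) *m vec M) 0 0 = bform M u x.
Proof. by rewrite tens_vec. Qed.

Lemma regressor_mxE L X Y Z (t : 'I_l.-1) : X^T = X -> Z^T = Z ->
  let x := xb t.+1 in let u := ub t.+1 in let x' := A *m x + B *m u in
  (regressor_mx gamma l L xb ub *m unknowns X Y Z) t 0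
  = bform X x x - gamma * bform X x' x' + 2 * bform Y u x
    + 2 * bform Y (L *m x) x + bform Z u u - bform Z (L *m x) (L *m x).
Proof.
move=> sX sZ x u x'.
transitivity ((row t (regressor_mx gamma l L xb ub) *m unknowns X Y Z) 0 0).
  by rewrite -row_mul [RHS]mxE.
rewrite rowK /regressor_row -/x -/u xbS -/x -/u -/x'.
rewrite tensmx_mul mulmx1 -trmx_mul !mul_row_col !mulmxDl !mulNmx -!scalemxAl.
have addE (M M' : 'M[R]_1) : (M + M') 0 0 = M 0 0 + M' 0 0 by rewrite mxE.
have oppE (M : 'M[R]_1) : (- M) 0 0 = - M 0 0 by rewrite mxE.
have scaleE c (M : 'M[R]_1) : (c *: M) 0 0 = c * M 0 0 by rewrite mxE.
rewrite !(addE, oppE, scaleE) !quadvec_bform // !tens_bform; ring.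
Qed.

Lemma excitation_mxE X Y Z (t : 'I_l.-1) : X^T = X -> Z^T = Z ->
  let x := xb t.+1 in let u := ub t.+1 in
  (excitation_mx l xb ub *m unknowns X Y Z) t 0
  = bform X x x + bform Y u x + bform Z u u.
Proof.
move=> sX sZ x u.
transitivity ((row t (excitation_mx l xb ub) *m unknowns X Y Z) 0 0).
  by rewrite -row_mul [RHS]mxE.
rewrite rowK -/x -/u !mul_row_col.
have addE (M M' : 'M[R]_1) : (M + M') 0 0 = M 0 0 + M' 0 0 by rewrite mxE.
by rewrite !addE !quadvec_bform // tens_bform.
Qed.

(* Collecting the coefficients of [x x^T], [u x^T] and [u u^T] in a row of the
   regressor turns its kernel into a homogeneous Lyapunov equation. *)
Lemma regressor_mx_inj L :
  schur (Num.sqrt gamma *: (A - B *m L)) -> 0 < gamma ->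
  \rank (excitation_mx l xb ub) = ((n * n.+1)./2 + n * m + (m * m.+1)./2)%N ->
  forall y : 'cV_((n * n.+1)./2 + n * m + (m * m.+1)./2),
    regressor_mx gamma l L xb ub *m y = 0 -> y = 0.
Proof.
move=> sL g0 rk y.
rewrite -[y]vsubmxK -[usubmx y]vsubmxK.
(* Every vector encodes a triple with [X] and [Z] symmetric, so the kernel can be studied through
   quadratic forms. *)
have [X sX <-] := svec_surj (usubmx (usubmx y)).
have [Y <-] := vec_surj (dsubmx (usubmx y)).
have [Z sZ <-] := svec_surj (dsubmx y).
rewrite -/(unknowns X Y Z) => ker {y}.
(* Coefficients of a regressor row after the next state is replaced by [A *m x + B *m u]: [E1] pairs
   with [x x^T], [E2] with [u x^T], [E3] with [u u^T]. *)
pose E1 := X - gamma *: (A^T *m X *m A) + L^T *m Y + (L^T *m Y)^T - L^T *m Z *m L.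
pose E2 := 2 *: (Y - gamma *: (B^T *m X *m A)).
pose E3 := Z - gamma *: (B^T *m X *m B).
have sE1 : E1^T = E1.
  rewrite /E1 !raddfB /= !raddfD /= raddfN /= !linearZ /= !trmx_mul !trmxK sX sZ.
  by rewrite !mulmxA; congr (_ - _); rewrite addrAC.
have sE3 : E3^T = E3.
  by rewrite /E3 linearB /= linearZ /= !trmx_mul !trmxK sX sZ mulmxA.
have : excitation_mx l xb ub *m unknowns E1 E2 E3 = 0.
  apply/matrixP => t c; rewrite ord1 {c} excitation_mxE //.
  rewrite -ker regressor_mxE //.
  rewrite /E1 /E2 /E3 !bform_mxE !bformE.
  set x := xb _; set u := ub _.
  rewrite (bformC (A *m x) (B *m u) sX). by ring.
(* Full column rank of the excitation matrix forces all three coefficients to vanish. *)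
have fr : row_free (excitation_mx l xb ub)^T.
  by rewrite /row_free mxrank_tr rk.
move=> /(congr1 trmx); rewrite trmx_mul trmx0 => /eqP.
rewrite mulmx_free_eq0 // trmx_eq0 /unknowns.
rewrite !col_mx_eq0 => /andP[/andP[/eqP/(svec_eq0 sE1) E10 /eqP/vec_eq0 E20]].
move=> /eqP/(svec_eq0 sE3) E30.
have ZE : Z = gamma *: (B^T *m X *m B) by apply/subr0_eq.
have YE : Y = gamma *: (B^T *m X *m A).
  apply/subr0_eq; move/eqP: E20; rewrite scaler_eq0 pnatr_eq0 /=.
  by move/eqP.
(* With [Y] and [Z] substituted, [E1 = 0] reads [X = gamma (A - B L)^T X (A - B L)]. *)
have X0 : X = 0.
  apply: (lyapunov_eq0 sL sX) => v.
  rewrite -scalemxAl !bformE mulrA -expr2 sqr_sqrtr ?ltW //.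
  have : bform E1 v v = 0 by rewrite E10 /bform mulmx0 mul0mx mxE.
  rewrite /E1 YE ZE !bform_mxE.
  rewrite mulmxBl -mulmxA !bformE.
  by rewrite (bformC (A *m v) (B *m _) sX) => ?; lra.
by rewrite /unknowns YE ZE X0 !(mulmx0, mul0mx) !scaler0 !svec0 vec0 !col_mx0.
Qed.


End Regressor.
End LeastSquares.

(** * Expectations of random vectors and the mean dynamics *)

Section Means.
Context {d : measure_display} {T : measurableType d} {R : realType}.
Variable Pr : probability T R.

Lemma vec_Lfun_mulmx p r (M : 'M[R]_(p, r)) (X : T -> 'cV[R]_r) :
  vec_Lfun Pr 1%:E X -> vec_Lfun Pr 1%:E (fun om => M *m X om).
Proof.
move=> LX i.
rewrite (_ : (fun om => (M *m X om) i 0) = \sum_j M i j *: (fun om => X om j 0)).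
  by apply: rpred_sum => j _; apply: rpredZ; exact: LX.
by apply/funext => om; rewrite fct_sumE mxE.
Qed.

Lemma vec_LfunD r (X Y : T -> 'cV[R]_r) :
  vec_Lfun Pr 1%:E X -> vec_Lfun Pr 1%:E Y -> vec_Lfun Pr 1%:E (X \+ Y).
Proof.
move=> LX LY i.
rewrite (_ : (fun om => _) = (fun om => X om i 0) + (fun om => Y om i 0)).
  by apply: rpredD; [exact: LX | exact: LY].
by apply/funext => om; rewrite mxE.
Qed.

Lemma vec_Lfun_average N r (X : 'I_N -> T -> 'cV[R]_r) :
  (forall i, vec_Lfun Pr 1%:E (X i)) -> vec_Lfun Pr 1%:E (average X).
Proof.
move=> LX j.
rewrite (_ : (fun om => _) = N%:R^-1 *: \sum_i (fun om => X i om j 0)).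
  by apply: rpredZ; apply: rpred_sum => i _; exact: LX.
by apply/funext => om; rewrite /average !mxE summxE /= fct_sumE.
Qed.

Lemma vec_Lfun21 r (X : T -> 'cV[R]_r) :
  vec_Lfun Pr 2%:E X -> vec_Lfun Pr 1%:E X.
Proof.
by move=> LX j; apply: (Lfun_subset12 (fin_num_measure _ _ measurableT)); exact: LX.
Qed.

Lemma vec_meanD r (X Y : T -> 'cV[R]_r) :
  vec_Lfun Pr 1%:E X -> vec_Lfun Pr 1%:E Y ->
  vec_mean Pr (X \+ Y) = vec_mean Pr X + vec_mean Pr Y.
Proof.
move=> LX LY; apply/matrixP => i j; rewrite !mxE.
rewrite (_ : (fun om => _) = (fun om => X om i 0) \+ (fun om => Y om i 0)).
  by rewrite expectationD ?fineD ?expectation_fin_num.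
by apply/funext => om; rewrite mxE.
Qed.

Lemma vec_mean_mulmx p r (M : 'M[R]_(p, r)) (X : T -> 'cV[R]_r) :
  vec_Lfun Pr 1%:E X ->
  vec_mean Pr (fun om => M *m X om) = M *m vec_mean Pr X.
Proof.
move=> LX; apply/matrixP => i c; rewrite !mxE.
have LM s : \sum_(j <- s) M i j *: (fun om => X om j 0) \in Lfun Pr 1.
  by apply: rpred_sum => j _; apply: rpredZ; exact: LX.
rewrite (_ : (fun om => _) = \sum_j M i j *: (fun om => X om j 0)); last first.
  by apply/funext => om; rewrite fct_sumE mxE.
elim: (index_enum _) => [|j s IH].
  by rewrite !big_nil expectation_cst.
rewrite !big_cons expectationD ?LM //; last by apply: rpredZ; exact: LX.
rewrite fineD ?expectation_fin_num ?LM //; last by apply: rpredZ; exact: LX.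
rewrite IH mxE; congr (_ + _).
rewrite (_ : _ *: _ = M i j \o* (fun om => X om j 0)).
  by rewrite expectationZl ?fineM ?expectation_fin_num //; exact: LX.
by apply/funext => om; rewrite /= mulrC.
Qed.

Lemma averageE N r (X : 'I_N -> T -> 'cV[R]_r) :
  average X = \sum_i (fun om => N%:R^-1%:M *m X i om).
Proof.
apply/funext => om; rewrite /average fct_sumE scaler_sumr.
by apply: eq_bigr => i _; rewrite mul_scalar_mx.
Qed.

Lemma vec_mean_average0 N r (X : 'I_N -> T -> 'cV[R]_r) :
  (forall i, vec_Lfun Pr 1%:E (X i)) -> (forall i, vec_mean Pr (X i) = 0) ->
  vec_mean Pr (average X) = 0.
Proof.
move=> LX X0; rewrite averageE.
(* Integrability of the partial sums is carried along, since additivity of the mean requires it. *)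
suff [] : vec_Lfun Pr 1%:E (\sum_i (fun om => N%:R^-1%:M *m X i om))
  /\ vec_mean Pr (\sum_i (fun om => N%:R^-1%:M *m X i om)) = 0 by [].
elim/big_rec: _ => [|i Y _ [LY Y0]].
  have E j : (fun om => (0 : T -> 'cV[R]_r) om j 0) = (0 : T -> R).
    by apply/funext => om; rewrite mxE.
  split=> [j|]; first by rewrite E; exact: rpred0.
  by apply/matrixP => j c; rewrite !mxE E expectation_cst [RHS]mxE.
have LXi := vec_Lfun_mulmx (N%:R^-1%:M) (LX i).
split; first exact: vec_LfunD.
by rewrite vec_meanD // vec_mean_mulmx // X0 Y0 mulmx0 addr0.
Qed.

Section Dynamics.
Variables (N n m q : nat) (A G : 'M[R]_n) (B : 'M[R]_(n, m)) (D : 'M[R]_(n, q)).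
Variables (sigma : R) (x : 'I_N -> nat -> T -> 'cV[R]_n)
  (u : 'I_N -> nat -> T -> 'cV[R]_m) (w : 'I_N -> nat -> T -> 'cV[R]_q).
Hypotheses (N_gt0 : (0 < N)%N)
  (dynamics : forall i t om,
    x i t.+1 om = A *m x i t om + G *m average (fun j => x j t) om
                  + B *m u i t om + D *m w i t om)
  (noise : white_noise Pr sigma w)
  (inputs : forall i t, vec_Lfun Pr 1%:E (u i t))
  (x0 : forall i, vec_Lfun Pr 2%:E (x i 0%N)).

Lemma noise_Lfun i t : vec_Lfun Pr 1%:E (w i t).
Proof. by apply: vec_Lfun21; have [_ /(_ i t)[]] := noise. Qed.

Lemma state_Lfun i t : vec_Lfun Pr 1%:E (x i t).
Proof.
elim: t i => [|t IH] i; first exact/vec_Lfun21/x0.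
rewrite (_ : x i t.+1 = (((fun om => A *m x i t om) \+
    (fun om => G *m average (fun j => x j t) om)) \+ (fun om => B *m u i t om))
    \+ (fun om => D *m w i t om)); last exact/funext/dynamics.
do ![apply: vec_LfunD]; apply: vec_Lfun_mulmx.
- exact: IH.
- exact: vec_Lfun_average.
- exact: inputs.
- exact: noise_Lfun.
Qed.

(** The coupling term is the same for all agents, so averaging its [N] copies returns it and [G]
    joins [A]. *)
Lemma average_dynamics t om : average (fun i => x i t.+1) om
  = (A + G) *m average (fun i => x i t) om + B *m average (fun i => u i t) om
    + D *m average (fun i => w i t) om.
Proof.
have N0 : N%:R != 0 :> R by rewrite pnatr_eq0 -lt0n.
rewrite /average (eq_bigr _ (fun i _ => dynamics i t om)) !big_split /=.
rewrite -!mulmx_sumr !scalerDr !scalemxAr mulmxDl; congr (_ + _ *m _ + _ + _).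
by rewrite sumr_const card_ord -[X in _ *: X = _]scaler_nat scalerA mulVf // scale1r.
Qed.

Lemma mean_dynamics t :
  vec_mean Pr (average (fun i => x i t.+1))
  = (A + G) *m vec_mean Pr (average (fun i => x i t))
    + B *m vec_mean Pr (average (fun i => u i t)).
Proof.
rewrite (_ : average _ =
  ((fun om => (A + G) *m average (fun i => x i t) om)
   \+ (fun om => B *m average (fun i => u i t) om))
  \+ (fun om => D *m average (fun i => w i t) om));
  last exact/funext/average_dynamics.
have Lx := vec_Lfun_average (fun i => @state_Lfun i t).
have Lu := vec_Lfun_average (fun i => inputs i t).
have Lw := vec_Lfun_average (fun i => @noise_Lfun i t).
rewrite !vec_meanD; do ?[exact: vec_Lfun_mulmx | apply: vec_LfunD].
rewrite !vec_mean_mulmx // (@vec_mean_average0 _ _ (fun i => w i t)) //.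
- by rewrite mulmx0 addr0.
- by move=> i; exact: noise_Lfun.
move=> i; apply/matrixP => j c; rewrite !mxE.
by have [_ /(_ i t)[_ -> _]] := noise.
Qed.

End Dynamics.
End Means.

(** * Removing the discount, and positivity of the input weight *)

Section DiscountedProblem.
Context {R : realType}.
Variables (gamma : R) (n m : nat).
Hypothesis gamma_gt0 : 0 < gamma.
Implicit Types (A Q P G Gam X : 'M[R]_n) (B : 'M[R]_(n, m)) (Rw : 'M[R]_m).
Implicit Types (K L : 'M[R]_(m, n)).
Local Notation s := (Num.sqrt gamma).

Lemma sqrt_gammaK : s * s = gamma.
Proof. by rewrite -expr2 sqr_sqrtr // ltW. Qed.

Lemma sqrt_gamma_congr n1 n2 (Y : 'M[R]_(n, n1)) X (Z : 'M[R]_(n, n2)) :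
  (s *: Y)^T *m X *m (s *: Z) = gamma *: (Y^T *m X *m Z).
Proof. by rewrite -scalemxAr [(_ *: Y)^T]linearZ /= -!scalemxAl scalerA sqrt_gammaK. Qed.

Lemma discounted_closed_loop A B L : s *: A - s *: B *m L = s *: (A - B *m L).
Proof. by rewrite scalerBr scalemxAl. Qed.

Lemma input_weightE B Rw X :
  input_weight (s *: B) Rw X = Rw + gamma *: (B^T *m X *m B).
Proof. by rewrite /input_weight sqrt_gamma_congr. Qed.

Lemma greedy_riccati_gain A B Rw X :
  Rw + gamma *: (B^T *m X *m B) \in unitmx ->
  greedy (s *: A) (s *: B) Rw X (riccati_gain gamma A B Rw X).
Proof.
move=> uW; rewrite /greedy input_weightE sqrt_gamma_congr /riccati_gain.
by rewrite -scalemxAr -!mulmxA mulKVmx // !mulmxA.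
Qed.

Lemma policy_cost_discountedE A B Rw Q X L v :
  policy_cost (s *: A) (s *: B) Rw Q X L v
  = bform (gamma *: ((A - B *m L)^T *m X *m (A - B *m L)) + L^T *m Rw *m L + Q) v v.
Proof.
rewrite /policy_cost discounted_closed_loop -[in LHS]bform_congr sqrt_gamma_congr.
by rewrite -bform_congr -!bform_addmx.
Qed.

Lemma riccati_policy_cost A B Rw Q P : Rw^T = Rw ->
  stabilizing_solution gamma A B Q Rw P -> forall v,
  bform P v v = policy_cost (s *: A) (s *: B) Rw Q P (riccati_gain gamma A B Rw P) v.
Proof.
move=> sR [sP uW PE _] v; set L := riccati_gain _ _ _ _ _.
have gL : greedy (s *: A) (s *: B) Rw P L by exact: greedy_riccati_gain.
rewrite {1}PE.
(* Comparison with the zero gain: the cost of [L] is that of no control minus the form of [L^T W L],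
   which is the shape of the Riccati right side. *)
have C0 := policy_cost_square Q sR (0 : 'M[R]_(m, n)) v sP gL.
have -> : policy_cost (s *: A) (s *: B) Rw Q P L v
  = policy_cost (s *: A) (s *: B) Rw Q P 0 v
    - bform (input_weight (s *: B) Rw P) (L *m v) (L *m v).
  by rewrite C0 sub0r mulNmx -scaleN1r !bformE; ring.
rewrite policy_cost_discountedE mulmx0 subr0 -bform_congr -bform_submx.
congr bform; rewrite trmx0 mul0mx mul0mx addr0 addrAC; congr (_ - _).
rewrite -(mulmxA _ _ L) gL sqrt_gamma_congr /L /riccati_gain.
rewrite -scalemxAr linearZ /= -scalemxAl scalerA -expr2.
congr (_ *: _); rewrite !trmx_mul trmxK sP trmx_inv.
rewrite (_ : (Rw + gamma *: (B^T *m P *m B))^T = Rw + gamma *: (B^T *m P *m B)).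
  by rewrite !mulmxA.
by rewrite linearD /= linearZ /= !trmx_mul trmxK sP sR mulmxA.
Qed.

(** The congruence form shows that the mean-field state weight inherits symmetry and
    semidefiniteness from [Q]. *)
Lemma Qgam_square Q Gam :
  Q + Qgam Q Gam = (1%:M - Gam)^T *m Q *m (1%:M - Gam).
Proof.
rewrite /Qgam [(1%:M - Gam)^T]linearB /= trmx1 mulmxBl mul1mx mulmxBr mulmx1 mulmxBl.
by rewrite !opprB addrC; apply/matrixP => i j; rewrite !mxE; ring.
Qed.

(** Nonnegative stage costs make [Pi] satisfy a Lyapunov inequality, hence [Pi >= 0], and the input
    weight is at least [Rw > 0]. *)
Lemma detectability_input_weight A G B Q Rw Gam Pi :
  detectability_condition gamma A G Q Rw Gam ->
  stabilizing_solution gamma (A + G) B (Q + Qgam Q Gam) Rw Pi ->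
  posdef (input_weight (s *: B) Rw Pi).
Proof.
move=> [[_ Q0] [sR R0] _] Pist; have [sPi _ _ sL] := Pist.
have R_ge0 w : 0 <= bform Rw w w.
  by have [->|/R0/ltW//] := eqVneq w 0; rewrite bform0l.
have Pi0 v : 0 <= bform Pi v v.
  move: v; apply: (lyapunov_ge0 sL) => v.
  rewrite (riccati_policy_cost sR Pist v) /policy_cost discounted_closed_loop.
  by rewrite -[leRHS]addrA lerDl addr_ge0 // Qgam_square bform_congr; exact: Q0.
split=> [|w /R0 w0].
  by rewrite /input_weight linearD /= !trmx_mul trmxK sPi sR mulmxA.
rewrite -/(bform _ w w) bform_addmx bform_congr.
by apply: (lt_le_trans w0); rewrite lerDl.
Qed.

(** Testing the LMI at [(v, - L v)] gives [Y <= policy_cost Y L] for the stabilizing gain [L], hence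
    [Pi >= Y] by Lyapunov. The input weight at [Y] is the lower right block of the LMI, so it is
    positive, and the weight at [Pi] dominates it. *)
Lemma lmi_input_weight A G B Q Rw Gam Pi : Rw^T = Rw ->
  lmi_condition gamma A G B Q Rw Gam ->
  stabilizing_solution gamma (A + G) B (Q + Qgam Q Gam) Rw Pi ->
  posdef (input_weight (s *: B) Rw Pi).
Proof.
move=> sR [_ [Y [_ sY _ [_ HY]]]] Pist; have [sPi _ _ sL] := Pist.
set Ag := A + G in HY Pist sL *.
set q := Q + _ in HY Pist *.
have Hform v w : bform (Hmx gamma Ag B q Rw Y) (col_mx v w) (col_mx v w)
  = bform Y (s *: Ag *m v + s *: B *m w) (s *: Ag *m v + s *: B *m w)
    + bform Rw w w + bform q v v - bform Y v v.
  rewrite bform_block !bform_mxE -!scalemxAl !bformE !mulrA sqrt_gammaK; ring.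
have YPi v : 0 <= bform (Pi - Y) v v.
  move: v; apply: (lyapunov_ge0 sL) => v.
  rewrite !bform_submx (riccati_policy_cost sR Pist v) /policy_cost.
  set L := riccati_gain _ _ _ _ _.
  have : 0 <= bform (Hmx gamma Ag B q Rw Y)
      (col_mx v (- (L *m v))) (col_mx v (- (L *m v))).
    have [->|/HY/ltW//] := eqVneq (col_mx v (- (L *m v))) 0; by rewrite bform0l.
  have E : s *: Ag *m v + s *: B *m - (L *m v) = s *: (Ag - B *m L) *m v.
    by rewrite mulmxN mulmxA -mulmxBl discounted_closed_loop.
  rewrite Hform E discounted_closed_loop -(scaleN1r (L *m v)) !(bformZl Rw, bformZr Rw).
  by move=> ?; lra.
split=> [|w w0].
  by rewrite /input_weight linearD /= !trmx_mul trmxK sPi sR mulmxA.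
rewrite -/(bform _ w w).
have : 0 < bform (Hmx gamma Ag B q Rw Y) (col_mx 0 w) (col_mx 0 w).
  by apply: HY; rewrite col_mx_eq0 negb_and w0 orbT.
rewrite Hform mulmx0 add0r !bform0l addr0 subr0 => H; apply: (lt_le_trans H).
rewrite bform_addmx bform_congr addrC lerD2l -subr_ge0 -bform_submx.
exact: YPi.
Qed.

End DiscountedProblem.

(** * Entrywise convergence of matrices, and assembly of the theorem *)

Lemma cvg_mx_entries (R : realType) p r (X : nat -> 'M[R]_(p, r)) (Y : 'M[R]_(p, r)) :
  (forall i j, X k i j @[k --> \oo] --> Y i j) -> X k @[k --> \oo] --> Y.
Proof.
move=> H; apply/cvg_ballP => e e0.
have : \forall k \near \oo, forall ij : 'I_p * 'I_r,
    ball (Y ij.1 ij.2) e (X k ij.1 ij.2).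
  by apply: filter_forall => ij; exact: (cvg_ball (H ij.1 ij.2) e0).
by apply: filterS => k Hk; split=> // i j; exact: (Hk (i, j)).
Qed.

Theorem theorem4 (R : realType) (d : measure_display) (T : measurableType d)
  (Pr : probability T R) (N n m q l : nat)
  (A G Q Gam : 'M[R]_n) (B : 'M[R]_(n, m)) (Rw : 'M[R]_m) (D : 'M[R]_(n, q))
  (gamma sigma : R)
  (x : 'I_N -> nat -> T -> 'cV[R]_n)
  (u : 'I_N -> nat -> T -> 'cV[R]_m)
  (w : 'I_N -> nat -> T -> 'cV[R]_q)
  (P Pi : 'M[R]_n) (K Kbar : 'M[R]_(m, n))
  (Pi_ : nat -> 'M[R]_n) (Kb_ : nat -> 'M[R]_(m, n))
  (N_gt0 : (0 < N)%N) (gamma_gt0 : 0 < gamma) (gamma_lt1 : gamma < 1)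
  (Q_sym : Q^T = Q) (Rw_sym : Rw^T = Rw)
  (dynamics : forall i t om,
    x i t.+1 om = A *m x i t om + G *m average (fun j => x j t) om
                  + B *m u i t om + D *m w i t om)
  (noise : white_noise Pr sigma w)
  (inputs : forall i t, vec_Lfun Pr 1%:E (u i t))
  (H1 : initial_states Pr (fun i => x i 0%N) w)
  (H2 : both_stabilizable gamma A G B)
  (H34 : detectability_condition gamma A G Q Rw Gam \/ lmi_condition gamma A G B Q Rw Gam)
  (P_stab : stabilizing_solution gamma A B Q Rw P)
  (K_def : K = riccati_gain gamma A B Rw P)
  (Pi_stab : stabilizing_solution gamma (A + G) B (Q + Qgam Q Gam) Rw Pi)
  (Kbar_def : Kbar = riccati_gain gamma (A + G) B Rw Pi - K)
  (Kb0_stab : stabilizer gamma (A + G) B (Kb_ 0%N + K))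
  (PI : policy_iteration gamma A G B Q Rw Gam K Pi_ Kb_) :
  let calK k := (Rw + Lambda2 gamma B (Pi_ k)) *m (K + Kb_ k.+1) in
  let Qbar k := (K + Kb_ k)^T *m Rw *m (K + Kb_ k) + Q + Qgam Q Gam in
  let xbar t := vec_mean Pr (average (fun i => x i t)) in
  let ubar t := vec_mean Pr (average (fun i => u i t)) in
  let AA k := regressor_mx gamma l (K + Kb_ k) xbar ubar in
  let BB k := target_vec l (Qbar k) xbar in
  let dim := ((n * n.+1)./2 + n * m + (m * m.+1)./2)%N in
  (dim <= l.-1)%N ->
  \rank (excitation_mx l xbar ubar) = dim ->
  [/\ forall k,
        (AA k)^T *m AA k \in unitmx /\
        col_mx (col_mx (svec (Pi_ k)) (vec (calK k)))
               (svec (Lambda2 gamma B (Pi_ k)))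
        = invmx ((AA k)^T *m AA k) *m (AA k)^T *m BB k,
      Pi_ k @[k --> \oo] --> Pi
    & invmx (Rw + Lambda2 gamma B (Pi_ k)) *m calK k - K @[k --> \oo] --> Kbar].
Proof.
move=> calK Qbar xbar ubar AA BB dim _ rk.
have [sPi uPi _ Pi_schur] := Pi_stab.
pose a := Num.sqrt gamma *: (A + G); pose b := Num.sqrt gamma *: B.
pose qq := Q + Qgam Q Gam; pose L k := K + Kb_ k.
pose Ls := riccati_gain gamma (A + G) B Rw Pi.
have Pi_greedy : greedy a b Rw Pi Ls by exact: greedy_riccati_gain.
have PiE v : bform Pi v v = policy_cost a b Rw qq Pi Ls v.
  exact: riccati_policy_cost.
have W0 : posdef (input_weight b Rw Pi).
  case: H34 => H.
    exact: detectability_input_weight H Pi_stab.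
  exact: lmi_input_weight H Pi_stab.
have Ls_schur : schur (a - b *m Ls).
  by rewrite discounted_closed_loop; exact: Pi_schur.
have sPik k : (Pi_ k)^T = Pi_ k by have [] := PI k.
have PikE k v : bform (Pi_ k) v v = policy_cost a b Rw qq (Pi_ k) (L k) v.
  have [_ E _ _] := PI k.
  rewrite policy_cost_discountedE // {1}E; congr bform.
  by rewrite /L (mulmxDr B) opprD !addrA.
have Lgreedy k : greedy a b Rw (Pi_ k) (L k.+1).
  have [_ _ uW E] := PI k.
  by rewrite /L E addrC subrK; exact: greedy_riccati_gain.
have L0_schur : schur (a - b *m L 0%N).
  rewrite discounted_closed_loop (_ : L 0%N = Kb_ 0%N + K); first exact: Kb0_stab.
  exact: addrC.
have Lk_schur k : schur (a - b *m L k).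
  exact: (policy_iteration_schur Rw_sym sPi Pi_greedy PiE Ls_schur W0 sPik PikE
    Lgreedy L0_schur).
have xbarS t : xbar t.+1 = (A + G) *m xbar t + B *m ubar t.
  by have [_ _ x0 _] := H1; exact: (mean_dynamics N_gt0 dynamics noise inputs x0).
have uW k : Rw + Lambda2 gamma B (Pi_ k) \in unitmx by have [] := PI k.
(* The greedy equation turns the second unknown into the cross coefficient of the quadratic form of
   [Pi_ k] at the next state. *)
have calKE k : calK k = gamma *: (B^T *m Pi_ k *m (A + G)).
  have := Lgreedy k; rewrite /greedy input_weightE // sqrt_gamma_congr //.
have Kb_cvg : Kb_ k.+1 @[k --> \oo] --> Kbar.
  apply: cvg_mx_entries => i j.
  have C : L k i j @[k --> \oo] --> Ls i j.
    apply: (policy_gain_cvg Rw_sym sPi Pi_greedy PiE Ls_schur W0 sPik PikE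
      Lgreedy L0_schur).
    by rewrite input_weightE.
  have E k : Kb_ k.+1 i j = L k.+1 i j - K i j by rewrite /L mxE addrC addKr.
  under eq_cvg do rewrite E.
  have -> : Kbar i j = Ls i j - K i j.
    by rewrite Kbar_def -/Ls; move: (Ls) => Y; rewrite !mxE.
  apply: cvgB; last exact: cvg_cst.
  by rewrite (cvg_shiftS (fun k => L k i j)).
split; last 1 first.
- rewrite (_ : (fun k => _) = (fun k => Kb_ k.+1)) //.
  by apply/funext => k; rewrite /calK mulKmx // addrC addKr.
- move=> k.
  have inj : forall y : 'cV_dim, AA k *m y = 0 -> y = 0.
    apply: (@regressor_mx_inj _ gamma n m l (A + G) B xbar ubar xbarS (L k) _
      gamma_gt0 rk).
    by rewrite -discounted_closed_loop; exact: Lk_schur.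
  have uG := unitmx_gram inj; split=> //.
  (* The unknowns solve the linear system exactly, so cancelling the Gram matrix reduces the formula
     to [AA k] times the unknowns being [BB k]. *)
  rewrite -mulmxA; apply: (canRL (mulKmx uG)); rewrite -mulmxA; congr (_ *m _).
  apply/matrixP => t c; rewrite ord1 {c} [RHS]mxE.
  have sLam : (Lambda2 gamma B (Pi_ k))^T = Lambda2 gamma B (Pi_ k).
    by rewrite /Lambda2 linearZ /= !trmx_mul trmxK sPik mulmxA.
  have sQbar : (Qbar k)^T = Qbar k.
    rewrite /Qbar -addrA Qgam_square linearD /= !trmx_mul !trmxK Rw_sym Q_sym.
    by rewrite !mulmxA.
  rewrite [LHS](regressor_mxE gamma xbarS) // quadvec_bform //.
  set xt := xbar _; set ut := ubar _; rewrite -/(L k).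
  (* For these unknowns all terms in the measured input [ut] cancel; what is left of the row is the
     policy evaluation equation of [Pi_ k] at [xt]. *)
  have := PikE k xt; rewrite policy_cost_discountedE // calKE /Lambda2 /Qbar /qq.
  rewrite -/(L k) !(bform_congr, bform_addmx, bform_scalemx) mulmxBl -mulmxA !bformE => ->.
  rewrite !(bformC ((A + G) *m xt) (B *m _) (sPik k)).
  ring.
- by apply: cvg_mx_entries => i j;
    exact: (policy_value_cvg Rw_sym sPi Pi_greedy PiE Ls_schur W0 sPik PikE
      Lgreedy L0_schur).
Qed.
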